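(* Let $X_1,\dots,X_n$ be independent random vectors, $G=(V,E)$ a graph on $V=\{1,\dots,n\}$, $\{h_e\}_{e\in E}$ a collection of bivariate kernels, and $U=\sum_{e=(i,j)\in E}h_e(X_i,X_j)$. Let $N=|E|$ and let $d_{\max}$ be the maximum node degree of $G$. Let $b\ge 0$ and $\sigma^2\ge 0$ be real numbers, not both zero, and suppose that $$|h_e(X_i,X_j)-\mathbb{E}h_e(X_i,X_j)|\le b\quad\text{and}\quad \mathrm{Var}(h_e(X_i,X_j))\le\sigma^2\qquad\text{for all }e=(i,j)\in E.$$ Let $K=d_{\max}+1$ and $N_*=K\lceil N/K\rceil$. Then, for all $t>0$, $$\mathbb{P}\left(\frac{U-\mathbb{E}U}{N_*}>t\right)\le\exp\left\{-\frac{N_*t^2}{2(d_{\max}+1)(\sigma^2+bt/3)}\right\}.$$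
   Context: The random vectors $X_1,\dots,X_n\in\mathbb{R}^p$ are independent but not necessarily identically distributed. $G=(V,E)$ is an arbitrary deterministic simple undirected graph with at least one edge; each edge $e\in E$ is written as a pair $e=(i,j)$ in one fixed order of its endpoints. For each $e\in E$, $h_e:\mathbb{R}^p\times\mathbb{R}^p\to\mathbb{R}$ is a measurable function (kernel), which may depend on $e$ and need not be symmetric; the expectations $\mathbb{E}h_e(X_i,X_j)$ are finite. *)

(* Defs.v *)
From HB Require Import structures.
From mathcomp Require Import all_boot all_order all_algebra.
From mathcomp Require Import all_classical all_reals all_analysis.

Set Implicit Arguments.
Unset Strict Implicit.
Unset Printing Implicit Defensive.

Import Order.TTheory GRing.Theory Num.Theory.

Local Open Scope classical_set_scope.
Local Open Scope ring_scope.

Definition simple_graph (V : finType) (g : rel V) : Prop :=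
  symmetric g /\ irreflexive g.

Definition max_degree (V : finType) (g : rel V) : nat :=
  (\max_(i : V) #|[pred j | g i j]|)%N.

(* The edge set of [g], every edge {i, j} being written in exactly one of the
   two orders (i, j) and (j, i); hence #|E| is the number of edges of [g]. *)
Definition oriented_edge_set (V : finType) (g : rel V) (E : {set V * V}) : Prop :=
  (forall i j, (i, j) \in E -> g i j) /\
  (forall i j, g i j -> ((i, j) \in E) (+) ((j, i) \in E)).

Definition mutually_independent d d' (T : measurableType d)
    (T' : measurableType d') (R : realType) (P : probability T R)
    (I : finType) (X : I -> {RV P >-> T'}) : Prop :=
  forall (J : {set I}) (A : I -> set T'),
    (forall i, i \in J -> measurable (A i)) ->
    P (\bigcap_(i in [set` J]) (X i @^-1` A i)) =
    (\prod_(i in J) P (X i @^-1` A i))%E.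

(* R^p is [p.-tuple R] with the sigma-algebra generated by the coordinates,
   i.e. its Borel sigma-algebra. *)
Section graph_sum.
Context d (T : measurableType d) (R : realType) (P : probability T R).
Context (n p : nat) (X : 'I_n -> {RV P >-> p.-tuple R}).
Context (h : 'I_n * 'I_n ->
  p.-tuple R * p.-tuple R -> R).

Definition edge_term (e : 'I_n * 'I_n) (w : T) : R := h e (X e.1 w, X e.2 w).

Definition graph_sum (E : {set 'I_n * 'I_n}) (w : T) : R :=
  \sum_(e in E) edge_term e w.

End graph_sum.

(* Main.v *)
Require Import Defs.
From HB Require Import structures.
From mathcomp Require Import all_boot all_order all_algebra perm.
From mathcomp Require Import all_classical all_reals all_analysis.
From mathcomp Require Import measurable_realfun.
From mathcomp Require Import ring lra.

Set Implicit Arguments.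
Unset Strict Implicit.
Unset Printing Implicit Defensive.

Import Order.TTheory GRing.Theory Num.Theory.

Local Open Scope classical_set_scope.
Local Open Scope ring_scope.

(** Two edges without a common endpoint depend on disjoint groups of the
    independent vectors, so along a matching the edge terms are independent and
    Bernstein's moment bound multiplies.  By Vizing's theorem ([vizing]) the
    edges of [g] split into K = d_max + 1 matchings M_k, which turns the sum
    over all edges into K sums of independent terms that are arbitrarily
    dependent on each other.

    Put psi = s^2 sigma2 / 2 / (1 - s b / 3).  A centred variable bounded by b
    with variance at most sigma2 satisfies E exp(s Y) <= exp(psi)
    ([bernstein_mgf]), and independence ([matching_exp_moment]) gives
    E exp(a_k) <= 1 for a_k = sum over M_k of (s Y_e - psi).  Convexity of exp
    bounds exp of the average of the a_k by the average of the exp(a_k), so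
    P(sum_k a_k >= K B) <= exp(-B) whatever the dependence between the a_k
    ([exp_moment_average_tail]).  Now sum_k a_k = s (U - EU) - N psi, whence
    U - EU > N_* t and N <= N_* force sum_k a_k >= N_* (s t - psi), and the
    choice s = t / (sigma2 + b t / 3) makes s t - psi equal to
    t^2 / (2 (sigma2 + b t / 3)) when sigma2 > 0; the degenerate case is in
    [bernstein_parameter].

    Subtracting psi once per edge inside the exponent, before averaging, is what
    makes the sizes of the matchings irrelevant: only their total N enters, so
    the colouring does not have to be equitable.

    Independence is used through [expectation_prod_matching]: the expectation of
    a product over a matching factorizes.  The edges are added one at a time;
    the definition of independence covers events on single vertices, and a
    uniqueness argument on rectangles extends it to functions of a pair. *)

(** * Edge colourings: the theorem of Vizing *)

Section PathsInSparseGraphs.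
Variables (V : finType) (h : rel V).
Hypothesis hsym : symmetric h.
Hypothesis hdeg2 : forall x y1 y2 y3, h x y1 -> h x y2 -> h x y3 ->
  [\/ y1 = y2, y1 = y3 | y2 = y3].

Definition endpoint x := forall y z, h x y -> h x z -> y = z.

(** Degrees at most two make a walk that never turns back deterministic, so two
    such walks leaving [z] through [x] follow the same route, and neither can
    go past an endpoint. *)
Lemma walk_to_endpoint_unique z x p q :
  h x z -> path h x p -> path h x q ->
  uniq [:: z, x & p] -> uniq [:: z, x & q] ->
  endpoint (last x p) -> endpoint (last x q) -> last x p = last x q.
Proof.
elim: p z x q => [|y p IH] z x [|y' q] //= xz.
- move=> _ /andP[xy' _] _ /andP[+ _] end_x _.
  by rewrite (end_x _ _ xz xy') !inE eqxx orbT.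
- move=> /andP[xy _] _ /andP[+ _] _ _ end_x.
  by rewrite (end_x _ _ xz xy) !inE eqxx orbT.
move=> /andP[xy hp] /andP[xy' hq] /andP[zp up] /andP[zq uq].
have yy' : y = y'.
  case: (hdeg2 xz xy xy') => // zE.
    by rewrite zE !inE eqxx orbT in zp.
  by rewrite zE !inE eqxx orbT in zq.
by rewrite -yy' in hq uq *; apply: IH hp hq up uq; rewrite hsym.
Qed.

(** A connected graph of maximal degree two is a path or a cycle, hence has at
    most two vertices of degree at most one. *)
Lemma three_endpoints x u v : endpoint x -> endpoint u -> endpoint v ->
  x != u -> x != v -> connect h x u -> connect h x v -> u = v.
Proof.
move=> end_x end_u end_v xu xv /connectP[p0 hp0 uE] /connectP[q0 hq0 vE].
case/shortenP: hp0 uE => p hp up _ uE {p0}.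
case/shortenP: hq0 vE => q hq uq _ vE {q0}.
case: p hp up uE => [|y p] hp up uE; first by rewrite uE eqxx in xu.
case: q hq uq vE => [|y' q] hq uq vE; first by rewrite vE eqxx in xv.
move: hp hq => /= /andP[xy hp] /andP[xy' hq].
rewrite -(end_x _ _ xy xy') /= in hq uq vE.
rewrite uE vE; apply: walk_to_endpoint_unique hp hq up uq _ _ => //.
- by rewrite hsym.
- by rewrite -[last _ _]uE.
- by rewrite -vE.
Qed.

End PathsInSparseGraphs.

Lemma sub_path_tail (T : eqType) (e e' : rel T) x s :
  (forall y z, y \in x :: s -> z \in s -> e y z -> e' y z) ->
  path e x s -> path e' x s.
Proof.
elim: s x => //= y s IH x sub /andP[xy ys]; apply/andP; split.
  by apply: sub xy; rewrite inE eqxx.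
by apply: IH ys => u v us vs; apply: sub; rewrite inE ?us ?vs orbT.
Qed.

Section EdgeColoring.
Variables (V : finType) (K : nat).
Implicit Types (c : V -> V -> option 'I_K) (x y z u v : V) (a b : 'I_K).

(** A partial colouring of the edges is a symmetric function on pairs of
    vertices, [None] marking the pairs that are not coloured edges. *)
Definition proper_coloring c :=
  [/\ forall u v, c u v = c v u,
      forall u, c u u = None
    & forall u v w a, c u v = Some a -> c u w = Some a -> v = w].

Definition missing c u a := [forall v, c u v != Some a].

Definition same_edge x y u v := [|| (u == x) && (v == y) | (u == y) && (v == x)].

Definition recolor c x y o u v := if same_edge x y u v then o else c u v.

Lemma missingP c u a : reflect (forall v, c u v <> Some a) (missing c u a).
Proof. by apply: (iffP forallP) => H v; apply/eqP. Qed.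

Lemma same_edgeC x y u v : same_edge x y u v = same_edge x y v u.
Proof. by rewrite /same_edge orbC ![(v == _) && _]andbC. Qed.

Lemma proper_erase c x y : proper_coloring c -> proper_coloring (recolor c x y None).
Proof.
move=> [csym cirr cprop]; split=> [u v|u|u v w a]; rewrite /recolor.
- by rewrite same_edgeC csym.
- by rewrite cirr if_same.
- by case: ifP => // _; case: ifP => // _; exact: cprop.
Qed.

Lemma proper_color_edge c x y a : proper_coloring c -> x != y ->
  missing c x a -> missing c y a -> proper_coloring (recolor c x y (Some a)).
Proof.
move=> [csym cirr cprop] xy /missingP xa /missingP ya.
split=> [u v|u|u v w b]; rewrite /recolor.
- by rewrite same_edgeC csym.
- rewrite /same_edge cirr; have [->|_] /= := eqVneq u x.
    by rewrite (negbTE xy).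
  by rewrite andbF.
- rewrite /same_edge; have [->|ux] := eqVneq u x.
    rewrite (negbTE xy) /= !orbF.
    have [->|vy] := eqVneq v y; have [->|wy] := eqVneq w y => //.
    + by move=> [<-] /xa.
    + by move=> /[swap] -[<-] /xa.
    + exact: cprop.
  have [->|uy] /= := eqVneq u y; last exact: cprop.
  have [->|vy] := eqVneq v x; have [->|wy] := eqVneq w x => //.
  + by move=> [<-] /ya.
  + by move=> /[swap] -[<-] /ya.
  + exact: cprop.
Qed.

Definition extends_coloring c c' x y :=
  forall u v, (c' u v != None) = (c u v != None) || same_edge x y u v.

Definition fan_step c x y z := [exists a, (c x z == Some a) && missing c y a].

(** Along a fan every colour [c x z] can be moved one step back: the edge to [z]
    gives its colour to the edge to the preceding neighbour, where that colour
    is missing.  The uncoloured edge thereby travels to the end of the fan,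
    where [a] is available at both endpoints.  The induction moves it by one
    step, the remaining fan being still a fan for the new colouring. *)
Lemma fan_shift c x y s a : proper_coloring c -> c x y = None ->
  uniq [:: x, y & s] -> path (fan_step c x) y s ->
  missing c x a -> missing c (last y s) a ->
  exists2 c', proper_coloring c' & extends_coloring c c' x y.
Proof.
elim: s c y => [|z s IH] c y cP cxy.
  rewrite /= andbT inE => xy _ xa ya.
  exists (recolor c x y (Some a)); first exact: proper_color_edge.
  by move=> u v; rewrite /recolor; case: ifP => _ /=; rewrite ?orbT ?orbF.
have [csym cirr cprop] := cP.
move=> /= /and4P[]; rewrite !inE !negb_or => /and3P[xy xz xs] /andP[yz ys] zs us.
move=> /andP[/existsP[b /andP[/eqP cxz yb]] zs_fan] xa lasta.
pose c1 := recolor c x z None.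
have c1P : proper_coloring c1 by exact: proper_erase.
have xb1 : missing c1 x b.
  apply/missingP => v; rewrite /c1 /recolor; case: ifP => //= nxz cxv.
  by move: nxz; rewrite (cprop _ _ _ _ cxz cxv) /same_edge !eqxx.
have yb1 : missing c1 y b.
  apply/missingP => v; rewrite /c1 /recolor; case: ifP => //= _.
  exact/missingP.
pose c2 := recolor c1 x y (Some b).
have c2P : proper_coloring c2 by exact: proper_color_edge.
have missing2 u d : u != x -> u != y -> missing c u d -> missing c2 u d.
  move=> ux uy /missingP ud; apply/missingP => v.
  rewrite /c2 /c1 /recolor /same_edge (negbTE ux) (negbTE uy) /=.
  by case: ifP.
have c2x v : v != z -> v != y -> c2 x v = c x v.
  move=> vz vy; rewrite /c2 /c1 /recolor /same_edge (negbTE vz) (negbTE vy).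
  by rewrite (negbTE xy) (negbTE xz) andbF.
have c2z : c2 x z = None.
  rewrite /c2 /c1 /recolor /same_edge !eqxx /= [z == y]eq_sym.
  by rewrite (negbTE yz) (negbTE xy).
have neqx u : u \in z :: s -> u != x.
  rewrite inE => /predU1P[->|us']; first by rewrite eq_sym.
  by apply: contra xs => /eqP <-.
have neqy u : u \in z :: s -> u != y.
  rewrite inE => /predU1P[->|us']; first by rewrite eq_sym.
  by apply: contra ys => /eqP <-.
have [||||c' c'P c'E] := IH c2 z c2P c2z.
- by rewrite /= inE negb_or xz xs zs us.
- apply: sub_path_tail zs_fan => u v uzs vs /existsP[d /andP[cxv ud]].
  apply/existsP; exists d; rewrite c2x; last 2 first.
  + by apply: contra zs => /eqP <-.
  + by apply: neqy; rewrite inE vs orbT.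
  by rewrite cxv missing2 ?neqx ?neqy.
- apply/missingP => v; rewrite /c2 /c1 /recolor.
  case: ifP => [_ [ba]|_].
    by move/missingP/(_ z): xa; rewrite cxz ba.
  by case: ifP => // _; exact/missingP.
- by apply: missing2 lasta; rewrite ?neqx ?neqy ?mem_last.
exists c' => // u v; rewrite c'E /c2 /c1 /recolor.
case: (boolP (same_edge x y u v)) => [_|_]; rewrite ?orbT ?orbF //=.
case: (boolP (same_edge x z u v)) => [|_]; last by rewrite orbF.
by rewrite orbT /same_edge => /orP[|] /andP[/eqP -> /eqP ->];
  rewrite 1?[c z x]csym cxz.
Qed.

(** Exchanging [a] and [b] on a component of the graph of the edges coloured [a]
    or [b] keeps the colouring proper; it is the way to make [a] missing at a
    chosen vertex without altering the colours seen outside its component. *)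
Section Kempe.
Variables (c : V -> V -> option 'I_K) (a b : 'I_K).
Hypothesis cP : proper_coloring c.

Definition kempe u v := (c u v == Some a) || (c u v == Some b).

Lemma kempe_sym : symmetric kempe.
Proof. by case: cP => csym _ _ u v; rewrite /kempe csym. Qed.

Lemma kempe_deg2 x y1 y2 y3 : kempe x y1 -> kempe x y2 -> kempe x y3 ->
  [\/ y1 = y2, y1 = y3 | y2 = y3].
Proof.
case: cP => _ _ cprop.
move=> /orP[]/eqP c1 /orP[]/eqP c2 /orP[]/eqP c3;
  by [ constructor 1; apply: cprop c1 c2
     | constructor 2; apply: cprop c1 c3
     | constructor 3; apply: cprop c2 c3 ].
Qed.

Lemma kempe_endpoint x : missing c x a || missing c x b -> endpoint kempe x.
Proof.
case: cP => _ _ cprop.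
case/orP => /missingP xm y z /orP[]/eqP cy /orP[]/eqP cz;
  by [ case: (xm _ cy) | case: (xm _ cz) | apply: cprop cy cz].
Qed.

Variable w : V.

Definition kempe_swap u v :=
  if connect kempe w u then omap (tperm a b) (c u v) else c u v.

Lemma kempe_swap_proper : proper_coloring kempe_swap.
Proof.
have [csym cirr cprop] := cP; rewrite /kempe_swap; split.
- move=> u v; rewrite [c v u]csym.
  have [kuv|] := boolP (kempe u v).
    suff -> : connect kempe w u = connect kempe w v by [].
    apply/idP/idP => /connect_trans; apply; apply: connect1 => //.
    by rewrite kempe_sym.
  rewrite /kempe; case: (c u v) => [d|]; last by rewrite !if_same.
  rewrite negb_or /= => /andP[da db]; rewrite tpermD ?if_same //.
    by apply: contra da => /eqP ->.
  by apply: contra db => /eqP ->.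
- by move=> u; rewrite cirr if_same.
- move=> u v x d; case: ifP => _; last exact: cprop.
  case cuv: (c u v) => [d1|] //= [d1E]; case cux: (c u x) => [d2|] //= [d2E].
  apply: (cprop u v x d1) => //.
  by rewrite cux; congr Some; apply: (@perm_inj _ (tperm a b)); rewrite d2E d1E.
Qed.

Lemma kempe_swap_dom u v : (kempe_swap u v != None) = (c u v != None).
Proof. by rewrite /kempe_swap; case: ifP => // _; case: (c u v). Qed.

Lemma kempe_swap_out u v : ~~ connect kempe w u -> kempe_swap u v = c u v.
Proof. by rewrite /kempe_swap => /negbTE ->. Qed.

Lemma missing_swap_out u d : ~~ connect kempe w u ->
  missing kempe_swap u d = missing c u d.
Proof. by move=> wu; apply: eq_forallb => v; rewrite kempe_swap_out. Qed.

Lemma missing_swap_other u d : d != a -> d != b ->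
  missing c u d -> missing kempe_swap u d.
Proof.
move=> da db /missingP ud; apply/missingP => v; rewrite /kempe_swap.
case: ifP => // _; case cuv : (c u v) => [d'|] //= [d'E]; apply: (ud v).
rewrite cuv; congr Some; move: d'E => /(congr1 (tperm a b)).
by rewrite tpermK tpermD // eq_sym.
Qed.

Lemma missing_swap_root : missing c w b -> missing kempe_swap w a.
Proof.
move=> /missingP wb; apply/missingP => v; rewrite /kempe_swap connect0.
case cwv : (c w v) => [d|] //= [dE]; apply: (wb v); rewrite cwv; congr Some.
by move: dE => /(congr1 (tperm a b)); rewrite tpermK tpermL.
Qed.

(** An exchange that avoids [x] leaves the colours at [x] alone, so it can only
    disturb a step of the fan that concerns [a] or [b].  The colour [a] does not
    occur at [x], and [b] occurs only on the edge to [z]. *)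
Lemma fan_swap x y z s : ~~ connect kempe w x -> missing c x a ->
  c x z = Some b -> z \notin s -> path (fan_step c x) y s ->
  path (fan_step kempe_swap x) y s.
Proof.
case: cP => _ _ cprop.
move=> wx /missingP xa cxz zs; apply: sub_path_tail => u v _ vs.
move=> /existsP[d /andP[/eqP cxv ud]]; apply/existsP; exists d.
rewrite kempe_swap_out // cxv eqxx /=; apply: missing_swap_other ud.
  by apply/eqP => da; apply: (xa v); rewrite cxv da.
apply: contra zs => /eqP db.
have cxvb : c x v = Some b by rewrite cxv db.
by rewrite (cprop _ _ _ _ cxz cxvb).
Qed.

End Kempe.

(** A fan is grown from [y] until it can be shifted.  Let [a] be missing at [x]
    and [b] at the last vertex [v] of the fan.  If [b] is missing at [x] too,
    shifting works at once; otherwise [b] is the colour of some edge [x z].  If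
    [z] is new, the fan grows.  If [z] is in the fan, its predecessor [u] also
    misses [b], so [x], [u] and [v] are three endpoints in the graph of the
    colours [a] and [b] and one of [u], [v] is not in the component of [x].
    Exchanging the colours on its component makes [a] missing there: then the
    fan up to [u], or the whole fan, can be shifted. *)
Lemma extend_coloring c x y : proper_coloring c -> x != y -> c x y = None ->
  (forall u, exists a, missing c u a) ->
  exists2 c', proper_coloring c' & extends_coloring c c' x y.
Proof.
move=> cP xy cxy missing_ex; have [csym cirr cprop] := cP.
have [a xa] := missing_ex x.
suff fan_ind n s : (#|V| <= n + size s)%N -> uniq [:: x, y & s] ->
    path (fan_step c x) y s ->
    exists2 c', proper_coloring c' & extends_coloring c c' x y.
  by apply: (fan_ind #|V| [::]); rewrite ?addn0 //= inE xy.
elim: n s => [|n IH] s sz us fan_s.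
  by have := leq_trans (max_card (mem [:: x, y & s])) sz;
    rewrite (card_uniqP us) /= add0n ltnNge leqnSn.
have [b lb] := missing_ex (last y s).
have [xb|] := boolP (missing c x b); first exact: fan_shift lb.
rewrite negb_forall => /existsP[z]; rewrite negbK => /eqP cxz.
have zx : z != x by apply: contraPneq cxz => ->; rewrite cirr.
have zy : z != y by apply: contraPneq cxz => ->; rewrite cxy.
have [zs|zs] := boolP (z \in s); last first.
  apply: (IH (rcons s z)); first by rewrite size_rcons addnS -addSn.
    by rewrite -!rcons_cons rcons_uniq us andbT !inE !negb_or zx zy.
  by rewrite rcons_path fan_s; apply/existsP; exists b; rewrite cxz eqxx lb.
case/splitPr: zs us fan_s lb {sz} => s1 s2 us.
rewrite cat_path last_cat /= => /and3P[fan1 step fan2] lb.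
set u := last y s1 in step; set v := last z s2 in lb.
have ub : missing c u b.
  by case/existsP: step => d /andP[]; rewrite cxz => /eqP[->].
have [xs1 xs2] : x \notin y :: s1 /\ x \notin z :: s2.
  by move: us; rewrite -cat_cons cons_uniq mem_cat negb_or => /andP[/andP[]].
have us1 : uniq (y :: s1) /\ uniq (z :: s2) /\ ~~ has (mem (y :: s1)) (z :: s2).
  by move: us; rewrite -cat_cons cons_uniq cat_uniq => /andP[_ /and3P[]].
have {us1} [us1 [us2 disj]] := us1.
have u1 : u \in y :: s1 by exact: mem_last.
have v2 : v \in z :: s2 by exact: mem_last.
have xu : x != u by apply: contraNneq xs1 => ->.
have xv : x != v by apply: contraNneq xs2 => ->.
have uv : u <> v.
  by move=> uv; case/negP: disj; apply/hasP; exists v => //=; rewrite -uv.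
have zs1 : z \notin s1.
  apply: contra disj => zs1; apply/hasP; exists z; rewrite ?inE ?eqxx //=.
  by rewrite zs1 orbT.
have zs2 : z \notin s2 by move: us2 => /= /andP[].
have kend t : missing c t a || missing c t b -> endpoint (kempe c a b) t.
  exact: kempe_endpoint.
have ksym : connect_sym (kempe c a b) by exact/sym_connect_sym/kempe_sym.
have [xCu|xCu] := boolP (connect (kempe c a b) x u).
  (* The step from [u] to [z] is the only one with colour [b]; it survives the
     exchange because [u] is in the component of [x], not in that of [v]. *)
- have vCx : ~~ connect (kempe c a b) v x.
    apply/negP; rewrite ksym => xCv; apply: uv.
    apply: (three_endpoints (kempe_sym a b cP) (kempe_deg2 cP) _ _ _ xu xv xCu xCv);
      by apply: kend; rewrite ?xa ?ub ?lb ?orbT.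
  have vCu : ~~ connect (kempe c a b) v u.
    by apply: contra vCx => /connect_trans; apply; rewrite ksym.
  have [||||||c' c'P c'E] :=
      @fan_shift (kempe_swap c a b v) x y (s1 ++ z :: s2) a.
  + exact: kempe_swap_proper.
  + by rewrite kempe_swap_out.
  + exact: us.
  + rewrite cat_path /=; apply/and3P; split.
    * exact: fan_swap vCx xa cxz zs1 fan1.
    * apply/existsP; exists b.
      by rewrite kempe_swap_out // cxz eqxx /= missing_swap_out.
    * exact: fan_swap vCx xa cxz zs2 fan2.
  + by rewrite missing_swap_out.
  + by rewrite last_cat /=; exact: missing_swap_root.
  exists c' => // t1 t2; rewrite c'E kempe_swap_dom //.
have uCx : ~~ connect (kempe c a b) u x by rewrite ksym.
have [||||||c' c'P c'E] := @fan_shift (kempe_swap c a b u) x y s1 a.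
- exact: kempe_swap_proper.
- by rewrite kempe_swap_out.
- by rewrite cons_uniq xs1.
- exact: fan_swap uCx xa cxz zs1 fan1.
- by rewrite missing_swap_out.
- exact: missing_swap_root.
by exists c' => // t1 t2; rewrite c'E kempe_swap_dom.
Qed.

Lemma missing_color c (g : rel V) x :
  (forall y, c x y != None -> g x y) -> (#|[pred y | g x y]| < K)%N ->
  exists a, missing c x a.
Proof.
move=> cg degK; apply/existsP; apply: contraT; rewrite negb_exists => /forallP none.
have ex a : exists y, c x y == Some a.
  by have := none a; rewrite negb_forall => /existsP[y]; rewrite negbK; exists y.
have cK a : c x (xchoose (ex a)) = Some a by exact/eqP/(xchooseP (ex a)).
apply: contraTT degK => _; rewrite -leqNgt.
rewrite -[K in (K <= _)%N]card_ord -cardsT.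
have inj : injective (fun a => xchoose (ex a)).
  by move=> a a' eq_y; apply: Some_inj; rewrite -!cK eq_y.
rewrite -(card_imset _ inj); apply: subset_leq_card; apply/fintype.subsetP => y.
by move=> /imsetP[a _ ->]; rewrite inE cg // cK.
Qed.

(** Every vertex has fewer than [K] neighbours, so it always misses a colour and
    the uncoloured edges can be coloured one after the other. *)
Theorem vizing (g : rel V) : symmetric g -> irreflexive g ->
  (forall x, (#|[pred y | g x y]| < K)%N) ->
  exists2 c, proper_coloring c & forall x y, (c x y != None) = g x y.
Proof.
move=> gsym girr gdeg.
suff color_ind n c : (#|[pred e | g e.1 e.2 && (c e.1 e.2 == None)]| <= n)%N ->
    proper_coloring c -> (forall x y, c x y != None -> g x y) ->
    exists2 c, proper_coloring c & forall x y, (c x y != None) = g x y.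
  by apply: (color_ind #|{: V * V}| (fun=> fun=> None)); rewrite ?max_card.
elim: n c => [|n IH] c.
  rewrite leqn0 => /eqP/card0_eq c0 cP cg; exists c => // x y.
  apply/idP/idP => [|gxy]; first exact: cg.
  by have := c0 (x, y); rewrite !inE /= gxy /= => /negbT.
move=> cn cP cg.
have [[x y]|c0] := pickP [pred e | g e.1 e.2 && (c e.1 e.2 == None)]; last first.
  by apply: (IH c) => //; rewrite eq_card0.
rewrite /= => /andP[gxy /eqP cxy].
have xy : x != y by apply: contraTneq gxy => ->; rewrite girr.
have [u|c' c'P c'E] := extend_coloring cP xy cxy.
  exact: missing_color (cg u) (gdeg u).
apply: (IH c') => // [|u v]; last first.
  rewrite c'E => /orP[/cg //|]; rewrite /same_edge.
  by case/orP => /andP[/eqP -> /eqP ->] //; rewrite gsym.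
rewrite -ltnS; apply: leq_trans cn; apply: proper_card; apply/fintype.properP; split.
  apply/fintype.subsetP => -[u v]; rewrite !inE /= => /andP[-> /eqP c'uv].
  by have := c'E u v; rewrite c'uv eqxx /=; case: eqP.
exists (x, y); rewrite !inE /= ?gxy ?cxy ?eqxx //=.
by rewrite -[_ == None]negbK c'E /same_edge !eqxx /= orbT.
Qed.

End EdgeColoring.

(** * Factorization of expectations over a matching *)

Section WeightedIntegrals.
Context d d' (T : measurableType d) (Y : measurableType d') (R : realType).
Variables (mu : {measure set T -> \bar R}) (phi : T -> Y).
Hypothesis mphi : measurable_fun setT phi.
Local Open Scope ereal_scope.

Import HBNNSimple.

Lemma integral_nnsfun_weight (f : {nnsfun Y >-> R}) (W : T -> R) :
  measurable_fun setT W -> (forall w, 0 <= W w)%R ->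
  \int[mu]_w (f (phi w) * W w)%:E =
  \sum_(k \in range f)
    k%:E * \int[mu]_(w in phi @^-1` (f @^-1` [set k])) (W w)%:E.
Proof.
move=> mW W0.
have mpre k : measurable (phi @^-1` (f @^-1` [set k])).
  by rewrite -[X in measurable X]setTI; exact: mphi.
transitivity (\int[mu]_w (\sum_(k \in range f)
   k%:E * (\1_(f @^-1` [set k]) (phi w))%:E * (W w)%:E)).
  apply: eq_integral => w _; rewrite EFinM fimfunE -fsumEFin //.
  rewrite ge0_mule_fsuml// => k; exact: nnfun_muleindic_ge0.
rewrite ge0_integral_fsum //; last 2 first.
- move=> k; apply/measurable_EFinP/measurable_funM => //.
  apply: measurable_funM => //.
  by apply: measurableT_comp mphi; exact: measurable_indic.
- move=> k w _; apply: mule_ge0; last by rewrite lee_fin.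
  exact: nnfun_muleindic_ge0.
apply: eq_fsbigr => k; rewrite inE => -[y _ <-].
under eq_integral do rewrite -muleA.
rewrite ge0_integralZl //; last 3 first.
- apply/measurable_EFinP/measurable_funM => //.
  by apply: measurableT_comp mphi; exact: measurable_indic.
- by move=> w _; rewrite -EFinM lee_fin mulr_ge0.
- by rewrite lee_fin.
congr (_ * _); rewrite [RHS]integral_mkcond; apply: eq_integral => w _.
rewrite patchE indicE; set B := f @^-1` _.
have -> : (w \in phi @^-1` B) = (phi w \in B) by apply/idP/idP; rewrite !inE.
by case: ifP; rewrite ?mul1e ?mul0e.
Qed.

(** If the weight [W] gives every event of the sigma-algebra of [phi] a mass
    proportional to its measure, then [W] behaves as a constant under the
    integral of any function of [phi]: this is clear for simple functions and
    passes to monotone limits. *)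
Lemma integral_weight_factor (F : Y -> R) (W : T -> R) (c : R) :
  measurable_fun setT F -> (forall y, 0 <= F y)%R ->
  measurable_fun setT W -> (forall w, 0 <= W w)%R -> (0 <= c)%R ->
  (forall B, measurable B ->
     \int[mu]_(w in phi @^-1` B) (W w)%:E = c%:E * mu (phi @^-1` B)) ->
  \int[mu]_w (F (phi w) * W w)%:E = c%:E * \int[mu]_w (F (phi w))%:E.
Proof.
move=> mF F0 mW W0 c0 WE.
have mEF : measurable_fun setT (EFin \o F) by exact/measurable_EFinP.
pose f := nnsfun_approx measurableT mEF.
have cvgf y : (EFin \o f^~ y) x @[x --> \oo] --> (F y)%:E.
  by apply: cvg_nnsfun_approx => // z _; rewrite lee_fin.
have ndf y : {homo f^~ y : n m / (n <= m)%N >-> (n <= m)%R}.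
  by move=> n m nm; exact/lefP/nd_nnsfun_approx.
have mfphi n : measurable_fun setT (f n \o phi) by exact: measurableT_comp.
have approx (V : T -> R) : measurable_fun setT V -> (forall w, 0 <= V w)%R ->
    \int[mu]_w (F (phi w) * V w)%:E =
    limn (fun n => \int[mu]_w (f n (phi w) * V w)%:E).
  move=> mV V0; rewrite -monotone_convergence //.
  - apply: eq_integral => w _; apply/esym/cvg_lim => //.
    rewrite EFinM; under eq_fun do rewrite EFinM.
    by apply: cvgeZr => //; exact: cvgf.
  - by move=> n; apply/measurable_EFinP/measurable_funM => //; exact: mfphi.
  - by move=> n w _; rewrite lee_fin mulr_ge0.
  - by move=> w _ n m nm; rewrite lee_fin ler_wpM2r// ndf.
have cst1 n : \int[mu]_w (f n (phi w) * W w)%:E =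
    c%:E * \int[mu]_w (f n (phi w) * cst 1%R w)%:E.
  rewrite integral_nnsfun_weight // integral_nnsfun_weight //.
  rewrite ge0_mule_fsumr; last first.
    (* A value outside the range could be negative, but its level set is empty. *)
    move=> k; case: (boolP (k \in range (f n))).
      rewrite inE => -[y _ <-]; apply: mule_ge0; first by rewrite lee_fin.
      by apply: integral_ge0 => w _; rewrite lee_fin.
    move=> kf; rewrite (_ : f n @^-1` [set k] = set0) ?preimage_set0.
      by rewrite integral_set0 mule0.
    rewrite -subset0 => y /= fk; move: kf; rewrite notin_setE; apply.
    by exists y.
  apply: eq_fsbigr => k _; have mk : measurable (f n @^-1` [set k]) by [].
  have mpre : measurable (phi @^-1` (f n @^-1` [set k])).
    by rewrite -[X in measurable X]setTI; exact: mphi.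
  have -> : \int[mu]_(w in phi @^-1` (f n @^-1` [set k])) (cst 1%R w)%:E =
      mu (phi @^-1` (f n @^-1` [set k])).
    by rewrite (eq_integral (cst 1)) // integral_cst // mul1e.
  by rewrite WE // muleCA.
rewrite approx //; under eq_fun do rewrite cst1.
rewrite limeMl //; last first.
  apply: ereal_nondecreasing_is_cvgn => n m nm; apply: ge0_le_integral => //.
  - by move=> w _; rewrite lee_fin mulr_ge0.
  - by apply/measurable_EFinP/measurable_funM => //; exact: mfphi.
  - by apply/measurable_EFinP/measurable_funM => //; exact: mfphi.
  - by move=> w _; rewrite lee_fin ler_wpM2r// ndf.
rewrite -approx //; congr (_ * _).
by apply: eq_integral => w _; rewrite mulr1.
Qed.

End WeightedIntegrals.

Section WeightedPair.
Context d d1 d2 (T : measurableType d) (Y1 : measurableType d1)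
  (Y2 : measurableType d2) (R : realType) (P : probability T R).
Variables (X1 : T -> Y1) (X2 : T -> Y2).
Hypotheses (mX1 : measurable_fun setT X1) (mX2 : measurable_fun setT X2).
Local Open Scope ereal_scope.

(** Both sides are finite measures in [C], and rectangles form a pi-system that
    generates the product sigma-algebra. *)
Lemma weight_rectangles (W : T -> R) (c : R) :
  measurable_fun setT W -> (forall w, 0 <= W w)%R -> (0 <= c)%R ->
  (forall A B, measurable A -> measurable B ->
     \int[P]_(w in X1 @^-1` A `&` X2 @^-1` B) (W w)%:E =
     c%:E * P (X1 @^-1` A `&` X2 @^-1` B)) ->
  forall C, measurable C ->
    \int[P]_(w in (fun w => (X1 w, X2 w)) @^-1` C) (W w)%:E =
    c%:E * P ((fun w => (X1 w, X2 w)) @^-1` C).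
Proof.
move=> mW W0 c0 rectE C mC; pose phi w := (X1 w, X2 w).
have mphi : measurable_fun setT phi by exact: measurable_fun_pair.
have mEW : measurable_fun setT (EFin \o W) by exact/measurable_EFinP.
have EW0 w : 0 <= (EFin \o W) w by rewrite lee_fin.
pose density A := \int[P]_(w in A) (EFin \o W) w.
have density0 : density set0 = 0 by exact: integral_set0.
have density_ge0 A : 0 <= density A by exact: integral_ge0.
pose nu : measure T R := HB.pack density (isMeasure.Build _ T R density
  density0 density_ge0 (semi_sigma_additive_nng_induced mEW EW0)).
(* The image measure takes the measurability of [phi] as an argument, which
   cannot be inferred from [phi]; hence the explicit instance. *)
pose push (m : {measure set T -> \bar R}) :=
  measure_function_pushforward__canonical__measure_function_Measure m mphi.
pose cpi : measure _ R := mscale (NngNum c0) (push P).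
pose rect := [set A `*` B | A in (@measurable _ Y1) & B in (@measurable _ Y2)].
have -> : \int[P]_(w in phi @^-1` C) (W w)%:E = push nu C by [].
have -> : c%:E * P (phi @^-1` C) = cpi C by [].
apply: (@measure_unique _ R _ rect (fun=> setT)) => //.
- by rewrite measurable_prod_measurableType.
- move=> _ _ [A1 mA1 [B1 mB1 <-]] [A2 mA2 [B2 mB2 <-]]; rewrite -setXI.
  by exists (A1 `&` A2); [exact: measurableI|exists (B1 `&` B2); [exact: measurableI|]].
- by move=> _; exists setT => //; exists setT => //; rewrite setXTT.
- by rewrite bigcup_const //; exists 0%N.
- by move=> _ [A mA [B mB <-]]; exact: rectE.
- move=> _; have := rectE setT setT measurableT measurableT.
  rewrite !preimage_setT setIT probability_setT mule1 => nuT.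
  by rewrite [ltLHS]nuT ltry.
Qed.

End WeightedPair.

Section IndependentProducts.
Context d d' (T : measurableType d) (Y : measurableType d') (R : realType)
  (P : probability T R) (I : finType) (X : I -> {RV P >-> Y}).
Hypothesis indepX : mutually_independent X.
Local Open Scope ereal_scope.

Definition edge_vertices (M : seq (I * I)) := flatten [seq [:: e.1; e.2] | e <- M].

Definition cylinder (J : {set I}) (A : I -> set Y) :=
  \bigcap_(i in [set` J]) X i @^-1` A i.

Lemma measurable_cylinder J A : (forall i, measurable (A i)) ->
  measurable (cylinder J A).
Proof.
move=> mA; apply: fin_bigcap_measurable => // i _.
by rewrite -[X in measurable X]setTI; exact: measurable_funPT.
Qed.

Lemma cylinder0 A : cylinder finset.set0 A = setT.
Proof. by rewrite -subTset => w _ i /=; rewrite finset.in_set0. Qed.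

Lemma cylinderU1 (i : I) (J : {set I}) A :
  cylinder (i |: J)%SET A = X i @^-1` A i `&` cylinder J A.
Proof.
apply/seteqP; split => [w Aw|w [Aiw Aw] k /=].
  split; first by apply: Aw; rewrite /= finset.setU11.
  by move=> k /= kJ; apply: Aw; rewrite /= finset.setU1r.
by rewrite finset.in_setU1 => /predU1P[->//|]; exact: Aw.
Qed.

Lemma cylinder_prob J A : (forall i, measurable (A i)) ->
  P (cylinder J A) = \prod_(i in J) P (X i @^-1` A i).
Proof. by move=> mA; rewrite indepX. Qed.

(** The indicator of an event on the vertices in [J], all outside the matching,
    is carried along for the induction: to split off the edge [(i, j)] one has
    to test the remaining product against the rectangles in [(X i, X j)], and
    these are absorbed into the event by adding [i] and [j] to [J]. *)
Lemma expectation_prod_matching (F : I * I -> Y * Y -> R) (m : I * I -> R)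
    (M : seq (I * I)) (J : {set I}) (A : I -> set Y) :
  (forall e, e \in M -> measurable_fun setT (F e)) ->
  (forall e y, 0 <= F e y)%R ->
  (forall e, e \in M -> \int[P]_w (F e (X e.1 w, X e.2 w))%:E = (m e)%:E) ->
  uniq (edge_vertices M) -> {in edge_vertices M, forall i, i \notin J} ->
  (forall i, measurable (A i)) ->
  \int[P]_w ((\prod_(e <- M) F e (X e.1 w, X e.2 w)) * \1_(cylinder J A) w)%:E
  = (\prod_(e <- M) m e)%:E * P (cylinder J A).
Proof.
elim: M J A => [|[i j] M IH] J A mF F0 mE uM MJ mA.
  rewrite !big_nil mul1e; under eq_integral do rewrite big_nil mul1r.
  by rewrite integral_indic ?setIT //; exact: measurable_cylinder.
move: uM; rewrite /= inE negb_or => /and3P[/andP[ij iM] jM uM].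
have iJ : i \notin J by apply: MJ; rewrite /= inE eqxx.
have jJ : j \notin J by apply: MJ; rewrite /= !inE eqxx orbT.
have mF' e : e \in M -> measurable_fun setT (F e).
  by move=> eM; apply: mF; rewrite inE eM orbT.
have mE' e : e \in M -> \int[P]_w (F e (X e.1 w, X e.2 w))%:E = (m e)%:E.
  by move=> eM; apply: mE; rewrite inE eM orbT.
have m0 e : e \in (i, j) :: M -> (0 <= m e)%R.
  by move=> eM; rewrite -lee_fin -mE //; apply: integral_ge0 => w _; rewrite lee_fin.
pose phi w := (X i w, X j w).
pose W w := ((\prod_(e <- M) F e (X e.1 w, X e.2 w)) * \1_(cylinder J A) w)%R.
have mCyl := measurable_cylinder J mA.
pose c := ((\prod_(e <- M) m e) * fine (P (cylinder J A)))%R.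
have c0 : (0 <= c)%R.
  rewrite mulr_ge0 ?fine_ge0 // big_seq; apply: prodr_ge0 => e eM.
  by apply: m0; rewrite inE eM orbT.
have cE : c%:E = (\prod_(e <- M) m e)%:E * P (cylinder J A).
  by rewrite EFinM fineK // fin_num_measure.
have mphi k l : measurable_fun setT (fun w => (X k w, X l w)).
  by apply: measurable_fun_pair; exact: measurable_funPT.
have mprod : measurable_fun setT (fun w => \prod_(e <- M) F e (X e.1 w, X e.2 w))%R.
  by apply: measurable_prod => e eM; apply: measurableT_comp (mphi _ _); exact: mF'.
have mW : measurable_fun setT W.
  by apply: measurable_funM => //; exact: measurable_indic.
have W0 w : (0 <= W w)%R by rewrite mulr_ge0 // prodr_ge0.
transitivity (\int[P]_w (F (i, j) (phi w) * W w)%:E).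
  by apply: eq_integral => w _; rewrite big_cons mulrA.
rewrite (integral_weight_factor (mphi i j) _ _ mW W0 c0) //.
- by rewrite mE ?inE ?eqxx // big_cons cE muleAC -EFinM mulrC.
- by apply: mF; rewrite inE eqxx.
apply: (weight_rectangles (measurable_funPT (X i)) (measurable_funPT (X j)) mW) => //.
move=> B1 B2 mB1 mB2.
pose A' k := if k == i then B1 else if k == j then B2 else A k.
have mA' k : measurable (A' k) by rewrite /A'; case: ifP => // _; case: ifP.
have cylA' (J' : {set I}) : i \notin J' -> j \notin J' -> cylinder J' A' = cylinder J' A.
  move=> iJ' jJ'; apply: eq_bigcapr => k /= kJ; rewrite /A'.
  have [ki|_] := eqVneq k i; first by rewrite ki (negbTE iJ') in kJ.
  by have [kj|//] := eqVneq k j; rewrite kj (negbTE jJ') in kJ.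
have rectE (J' : {set I}) : i \notin J' -> j \notin J' -> cylinder (i |: (j |: J'))%SET A' =
    X i @^-1` B1 `&` X j @^-1` B2 `&` cylinder J' A.
  move=> iJ' jJ'; rewrite cylinderU1 // cylinderU1 // cylA' // setIA /A' eqxx.
  by rewrite eq_sym (negbTE ij) eqxx.
have rectP (J' : {set I}) : i \notin J' -> j \notin J' ->
    P (X i @^-1` B1 `&` X j @^-1` B2 `&` cylinder J' A) =
    P (X i @^-1` A' i) * P (X j @^-1` A' j) * P (cylinder J' A).
  move=> iJ' jJ'; rewrite -rectE // -cylA' // !cylinder_prob //.
  rewrite finset.big_setU1 /=; last by rewrite finset.in_setU1 negb_or ij.
  by rewrite finset.big_setU1 //= muleA.
have -> : c%:E * P (X i @^-1` B1 `&` X j @^-1` B2) =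
    (\prod_(e <- M) m e)%:E * P (cylinder (i |: (j |: J))%SET A').
  have := rectP finset.set0; rewrite !finset.in_set0 cylinder0 setIT => -> //.
  by rewrite probability_setT mule1 rectE // rectP // cE -muleA [P (cylinder J A) * _]muleC.
rewrite -IH //.
- rewrite integral_mkcond; apply: eq_integral => w _.
  rewrite patchE /W rectE // indicI /= [in RHS]indicE.
  by case: ifP => _; rewrite ?mul1r ?mul0r ?mulr0.
- move=> k kM; rewrite !finset.in_setU1 !negb_or.
  rewrite MJ ?inE ?kM ?orbT // andbT.
  by apply/andP; split; [apply: contraNneq iM => <- | apply: contraNneq jM => <-].
Qed.

End IndependentProducts.

(** * Exponential moments *)

Section BernsteinMoment.
Context (R : realType).

Lemma fact_ge_2_exp3 k : (2 * 3 ^ k <= (k.+2)`!)%N.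
Proof.
elim: k => // k IH; rewrite factS expnS mulnCA.
by apply: leq_mul IH.
Qed.

(** Comparison of the exponential series from its third term on with a geometric
    one of ratio [c / 3], because [(k + 2)! >= 2 * 3 ^ k]. *)
Lemma expR_quad_bound (y c : R) : `|y| <= c -> c < 3 ->
  expR y <= 1 + y + y ^+ 2 / 2 / (1 - c / 3).
Proof.
move=> yc c3; have c0 : 0 <= c by apply: le_trans yc.
have q1 : 0 < 1 - c / 3 by lra.
rewrite /expR; apply: limr_le; first exact: is_cvg_series_exp_coeff.
near=> n.
have -> : n = n.-2.+2 by rewrite -subn2 -addn2 subnK //; near: n; exists 2.
set m := n.-2; rewrite /series /= big_mkord 2!big_ord_recl /=.
rewrite /exp_coeff /= expr0 fact0 divr1 expr1 factS fact0 muln1 divr1 -addrA lerD2l lerD2l.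
apply: (@le_trans _ _ (\sum_(i < m) y ^+ 2 / 2 * (c / 3) ^+ i)).
  apply: ler_sum => i _; apply: (le_trans (ler_norm _)).
  rewrite normrM normrX normfV [`|_%:R|]ger0_norm ?ler0n //.
  rewrite /bump /= !add1n -addn2 addnC exprD real_normK ?num_real //.
  rewrite expr_div_n mulrACA -invfM; apply: ler_pM.
  - by apply: mulr_ge0; rewrite ?sqr_ge0 ?exprn_ge0.
  - by rewrite invr_ge0 ler0n.
  - by rewrite ler_wpM2l ?sqr_ge0 // lerXn2r ?nnegrE.
  rewrite lef_pV2 ?posrE ?mulr_gt0 ?exprn_gt0 ?ltr0n ?fact_gt0 //.
  by rewrite -natrX -natrM ler_nat addnC addn2 fact_ge_2_exp3.
rewrite -mulr_sumr; apply: ler_wpM2l; first by rewrite divr_ge0 ?sqr_ge0.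
rewrite -[leRHS]mul1r ler_pdivlMr // mulrC -opprB mulNr -subrX1 opprB.
by rewrite gerBl exprn_ge0 // divr_ge0.
Unshelve. all: end_near. Qed.

(** For [s2 > 0] the choice [s = t / (s2 + b * t / 3)] gives equality.  For
    [s2 = 0] it would give [s * b = 3], where the moment bound breaks down; but
    then the quadratic term vanishes and half of that value already gives
    equality. *)
Lemma bernstein_parameter (b s2 t : R) :
  0 <= b -> 0 <= s2 -> ~ (b = 0 /\ s2 = 0) -> 0 < t ->
  exists s, [/\ 0 <= s, s * b < 3 &
    t ^+ 2 / (2 * (s2 + b * t / 3)) <= s * t - s ^+ 2 * s2 / 2 / (1 - s * b / 3)].
Proof.
move=> b0 s20 nz t0; have [s2z|s2nz] := eqVneq s2 0.
  have bnz : b != 0 by apply/eqP => bz; apply: nz.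
  have bp : 0 < b by rewrite lt_neqAle eq_sym bnz.
  exists (3 / (2 * b)); split.
  - by rewrite divr_ge0 // mulr_ge0.
  - have -> : 3 / (2 * b) * b = 3 / 2 by field.
    lra.
  rewrite s2z mulr0 !mul0r subr0 add0r le_eqVlt; apply/orP; left; apply/eqP.
  by field; rewrite bnz (gt_eqF t0).
have s2p : 0 < s2 by rewrite lt_neqAle eq_sym s2nz.
have bt : 0 <= b * t / 3 by rewrite divr_ge0 // mulr_ge0 // ltW.
set D := s2 + b * t / 3.
have D0 : 0 < D by rewrite ltr_pwDl.
have Dn0 : D != 0 by rewrite gt_eqF.
have bE : b = 3 * (D - s2) / t by rewrite /D; field; rewrite gt_eqF.
exists (t / D); split; first by rewrite divr_ge0 // ltW.
  have -> : t / D * b = 3 * (1 - s2 / D).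
    by rewrite bE; field; rewrite Dn0 gt_eqF.
  have : 0 < s2 / D by rewrite divr_gt0.
  lra.
have -> : 1 - t / D * b / 3 = s2 / D.
  by rewrite bE; field; rewrite Dn0 gt_eqF.
rewrite le_eqVlt; apply/orP; left; apply/eqP; field.
by rewrite s2nz Dn0.
Qed.

End BernsteinMoment.

Section ExponentialMoments.
Context d (T : measurableType d) (R : realType) (P : probability T R).
Local Open Scope ereal_scope.

(** The quadratic majorant of the exponential is integrated: its linear term
    vanishes, and the result [1 + k * v] is at most [expR (k * v)]. *)
Lemma bernstein_mgf (Y : T -> R) (b v s : R) :
  P.-integrable setT (EFin \o Y) -> \int[P]_w (Y w)%:E = 0 ->
  \int[P]_w (Y w ^+ 2)%:E <= v%:E ->
  (0 <= b)%R -> {ae P, forall w, (`|Y w| <= b)%R} -> (0 <= s)%R -> (s * b < 3)%R ->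
  \int[P]_w (expR (s * Y w))%:E <= (expR (s ^+ 2 * v / 2 / (1 - s * b / 3)))%:E.
Proof.
move=> iY EY VY b0 aeb s0 sb3.
have mY : measurable_fun setT Y by exact/measurable_EFinP/(measurable_int _ iY).
have q1 : (0 < 1 - s * b / 3)%R by lra.
pose k := (s ^+ 2 / 2 / (1 - s * b / 3))%R.
have k0 : (0 <= k)%R by rewrite !mulr_ge0 ?sqr_ge0 ?invr_ge0 // ltW.
have mY2 : measurable_fun setT (fun w => Y w ^+ 2)%R by exact: measurable_funX.
have Y20 w : 0 <= (Y w ^+ 2)%:E by rewrite lee_fin sqr_ge0.
have iY2 : P.-integrable setT (fun w => (Y w ^+ 2)%:E).
  apply/integrableP; split; first exact/measurable_EFinP.
  under eq_integral do rewrite gee0_abs //.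
  by apply: le_lt_trans VY _; rewrite ltry.
pose G w := (1 + s * Y w + k * Y w ^+ 2)%R.
have mG : measurable_fun setT G.
  apply: measurable_funD; last exact: measurable_funM.
  by apply: measurable_funD => //; exact: measurable_funM.
(* [1 + x + x ^ 2 / 2] is nonnegative, hence so is the majorant, even where the
   almost sure bound on [Y] fails. *)
have k_half : (s ^+ 2 / 2 <= k)%R.
  rewrite /k ler_pdivlMr // ler_piMr ?divr_ge0 ?sqr_ge0 // lerBlDr lerDl.
  by rewrite divr_ge0 // mulr_ge0.
have G0 w : (0 <= G w)%R.
  have : (s ^+ 2 / 2 * Y w ^+ 2 <= k * Y w ^+ 2)%R by rewrite ler_wpM2r ?sqr_ge0.
  have : (0 <= (1 + s * Y w) ^+ 2)%R by exact: sqr_ge0.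
  rewrite /G; nra.
apply: (@le_trans _ _ (\int[P]_w (G w)%:E)).
  apply: ae_ge0_le_integral => //.
  - apply/measurable_EFinP; apply: measurableT_comp => //.
    exact: measurable_funM.
  - by move=> w _; rewrite lee_fin.
  - exact/measurable_EFinP.
  apply: filterS aeb => w Yb _; rewrite lee_fin.
  have := @expR_quad_bound R (s * Y w) (s * b); rewrite normrM (ger0_norm s0).
  move=> /(_ (ler_wpM2l s0 Yb) sb3) /le_trans; apply.
  by rewrite /G /k lerD2l le_eqVlt; apply/orP; left; apply/eqP; ring.
have -> : \int[P]_w (G w)%:E = 1 + k%:E * \int[P]_w (Y w ^+ 2)%:E.
  have i1 : P.-integrable setT (fun=> 1 : \bar R) by exact: finite_measure_integrable_cst.
  have isY : P.-integrable setT (fun w => s%:E * (Y w)%:E) by exact: integrableZl.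
  have ikY : P.-integrable setT (fun w => k%:E * (Y w ^+ 2)%:E) by exact: integrableZl.
  under eq_integral do rewrite /G !EFinD (EFinM s) (EFinM k).
  rewrite integralD //; last exact: integrableD.
  rewrite integralD // !integralZl // EY mule0 adde0.
  by rewrite integral_cst //= probability_setT mule1.
apply: (@le_trans _ _ (1 + k * v)%:E).
  by rewrite EFinD leeD2l // (EFinM k v) lee_wpmul2l.
rewrite lee_fin (_ : s ^+ 2 * v / 2 / (1 - s * b / 3) = k * v)%R ?expR_ge1Dx //.
by rewrite /k; ring.
Qed.

(** The tangent of the exponential at the mean lies below it; summing over [k]
    cancels the linear terms. *)
Lemma expR_average (K : nat) (a : 'I_K -> R) : (0 < K)%N ->
  (expR ((\sum_k a k) / K%:R) <= (\sum_k expR (a k)) / K%:R)%R.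
Proof.
move=> K0; have KR : (0 < K%:R :> R)%R by rewrite ltr0n.
rewrite ler_pdivlMr //; set m := ((\sum_k a k) / K%:R)%R.
apply: (@le_trans _ _ (\sum_k expR m * (1 + (a k - m)))%R).
  rewrite -mulr_sumr big_split /= sumrB !sumr_const card_ord -[(m *+ K)%R]mulr_natr.
  by rewrite divfK ?gt_eqF // subrr addr0.
apply: ler_sum => k _; rewrite -[in leRHS](subrK m (a k)) expRD mulrC.
by rewrite ler_wpM2r ?expR_ge0 // expR_ge1Dx.
Qed.

(** Chernoff's bound for an average; by convexity it needs a control of each
    [a k] separately and nothing on their joint law. *)
Lemma exp_moment_average_tail (K : nat) (a : 'I_K -> T -> R) (B : R) :
  (0 < K)%N -> (forall k, measurable_fun setT (a k)) ->
  (forall k, \int[P]_w (expR (a k w))%:E <= 1) ->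
  P [set w | K%:R * B <= \sum_k a k w]%R <= (expR (- B))%:E.
Proof.
move=> K0 ma a1; have KR : (0 < K%:R :> R)%R by rewrite ltr0n.
have msum : measurable_fun setT (fun w => \sum_k a k w)%R.
  exact: measurable_sum.
set A := [set w | _]; have mA : measurable A.
  rewrite (_ : A = (fun w => \sum_k a k w)%R @^-1` `[(K%:R * B)%R, +oo[%classic); last first.
    by apply/seteqP; split => w; rewrite /A /= in_itv /= andbT.
  by rewrite -[X in measurable X]setTI; exact: msum.
have mea k : measurable_fun setT (fun w => (expR (a k w))%:E).
  by apply/measurable_EFinP; apply: measurableT_comp (ma k).
have C0 : (0 <= expR (- B) / K%:R)%R by rewrite divr_ge0 ?expR_ge0 // ltW.
rewrite -(setIT A) -integral_indic //.
apply: (@le_trans _ _ (\int[P]_w ((expR (- B) / K%:R)%:E *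
    \sum_(k < K) (expR (a k w))%:E))).
  apply: ge0_le_integral => //.
  - by apply/measurable_EFinP; exact: measurable_indic.
  - apply: emeasurable_funM => //; exact: emeasurable_sum.
  move=> w _; rewrite sumEFin -EFinM lee_fin indicE.
  case: (boolP (w \in A)) => [|_]; last first.
    by rewrite mulr_ge0 // sumr_ge0 // => k _; exact: expR_ge0.
  rewrite inE /A /= => AB; rewrite mulrAC -mulrA.
  apply: (@le_trans _ _ (expR (- B) * expR ((\sum_k a k w) / K%:R))%R).
    by rewrite -expRD -[leLHS]expR0 ler_expR addrC subr_ge0 ler_pdivlMr // mulrC.
  by rewrite ler_wpM2l ?expR_ge0 // expR_average.
rewrite ge0_integralZl //; last 2 first.
- exact: emeasurable_sum.
- by move=> w _; apply: sume_ge0 => k _; rewrite lee_fin expR_ge0.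
rewrite ge0_integral_sum //.
apply: (@le_trans _ _ ((expR (- B) / K%:R)%:E * (K%:R)%:E)).
  apply: lee_wpmul2l; rewrite ?lee_fin //.
  apply: (@le_trans _ _ (\sum_(k < K) 1)); first exact: lee_sum.
  by rewrite sumEFin sumr_const card_ord.
by rewrite -EFinM lee_fin divfK ?gt_eqF.
Qed.

End ExponentialMoments.

(** * Matchings, colour classes and the tail bound *)

Section MatchingMoments.
Context d d' (T : measurableType d) (Y : measurableType d') (R : realType)
  (P : probability T R) (I : finType) (X : I -> {RV P >-> Y}).
Local Open Scope ereal_scope.

Lemma uniq_edge_vertices (M : seq (I * I)) :
  uniq M -> (forall e, e \in M -> e.1 != e.2) ->
  (forall e f, e \in M -> f \in M -> e != f ->
     [&& e.1 != f.1, e.1 != f.2, e.2 != f.1 & e.2 != f.2]) ->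
  uniq (edge_vertices M).
Proof.
elim: M => //= e M IH /andP[eM uM] irr disj.
have notin v : v \in edge_vertices M -> (v != e.1) && (v != e.2).
  move=> /flatten_mapP[f fM]; rewrite !inE => vf.
  have fe : f != e by apply: contraNneq eM => <-.
  have fM' : f \in e :: M by rewrite inE fM orbT.
  have /and4P[? ? ? ?] := disj f e fM' (mem_head _ _) fe.
  by case/orP: vf => /eqP ->; apply/andP.
rewrite inE negb_or irr ?mem_head //=; apply/and3P; split.
- by apply/negP => /notin; rewrite eqxx.
- by apply/negP => /notin; rewrite eqxx andbF.
- apply: IH => // [f fM|f1 f2 f1M f2M]; first by apply: irr; rewrite inE fM orbT.
  by apply: disj; rewrite inE ?f1M ?f2M orbT.
Qed.

Hypothesis indepX : mutually_independent X.

(** Normalizing each factor by [psi] makes every expectation in the product at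
    most one, so no power of [expR psi] depending on the size of [M] is left. *)
Lemma matching_exp_moment (h : I * I -> Y * Y -> R) (mu : I * I -> R)
    (M : seq (I * I)) (s psi : R) :
  (forall e, e \in M -> measurable_fun setT (h e)) ->
  uniq (edge_vertices M) ->
  (forall e, e \in M ->
     \int[P]_w (expR (s * (h e (X e.1 w, X e.2 w) - mu e)))%:E <= (expR psi)%:E) ->
  \int[P]_w (expR (\sum_(e <- M)
    (s * (h e (X e.1 w, X e.2 w) - mu e) - psi)))%:E <= 1.
Proof.
move=> mh uM mgf.
pose F e y := expR (s * (h e y - mu e) - psi).
have mF e : e \in M -> measurable_fun setT (F e).
  move=> eM; apply: measurableT_comp => //; apply: measurable_funB => //.
  by apply: measurable_funM => //; apply: measurable_funB => //; exact: mh.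
have mpair e : measurable_fun setT (fun w => (X e.1 w, X e.2 w)).
  by apply: measurable_fun_pair; exact: measurable_funPT.
have F0 e y : (0 <= F e y)%R by exact: expR_ge0.
have intF e : e \in M -> \int[P]_w (F e (X e.1 w, X e.2 w))%:E <= 1.
  move=> eM; have mexp : measurable_fun setT
      (fun w => (expR (s * (h e (X e.1 w, X e.2 w) - mu e)))%:E).
    apply/measurable_EFinP; apply: measurableT_comp => //.
    apply: measurable_funM => //; apply: measurable_funB => //.
    by apply: measurableT_comp (mpair e); exact: mh.
  under eq_integral do rewrite /F expRD mulrC EFinM.
  rewrite ge0_integralZl //.
  apply: (@le_trans _ _ ((expR (- psi))%:E * (expR psi)%:E)).
    by apply: lee_wpmul2l; [rewrite lee_fin expR_ge0|exact: mgf].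
  by rewrite -EFinM -expRD addNr expR0.
pose m e := fine (\int[P]_w (F e (X e.1 w, X e.2 w))%:E).
have mE e : e \in M -> \int[P]_w (F e (X e.1 w, X e.2 w))%:E = (m e)%:E.
  move=> eM; rewrite /m fineK // ge0_fin_numE.
    by apply: le_lt_trans (intF e eM) _; rewrite ltry.
  by apply: integral_ge0 => w _; rewrite lee_fin.
have := expectation_prod_matching indepX (J := finset.set0) (A := fun=> setT) mF F0 mE uM.
rewrite cylinder0 probability_setT mule1 => intprod.
rewrite (eq_integral (fun w =>
    ((\prod_(e <- M) F e (X e.1 w, X e.2 w)) * \1_setT w)%:E)); last first.
  by move=> w _; rewrite indicT mulr1 expR_sum.
rewrite intprod // => [|i _]; last by rewrite finset.in_set0.
rewrite lee_fin big_seq; apply: numdomain.Num.Theory.prodr_ile1 => e eM.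
have int0 : 0 <= \int[P]_w (F e (X e.1 w, X e.2 w))%:E.
  by apply: integral_ge0 => w _; rewrite lee_fin.
by have := intF e eM; move: int0; rewrite mE // !lee_fin => -> ->.
Qed.

End MatchingMoments.

Lemma measurable_sum_in d (T : measurableType d) (R : realType) (D : set T)
    (I : eqType) (s : seq I) (f : I -> T -> R) :
  (forall i, i \in s -> measurable_fun D (f i)) ->
  measurable_fun D (fun x => \sum_(i <- s) f i x).
Proof.
move=> mf; under eq_fun do rewrite big_seq big_mkcond.
apply: measurable_sum => i; case: (boolP (i \in s)) => [/mf //|_].
exact: measurable_cst.
Qed.

(** Two edges of one colour that share a vertex are the same unordered edge, and
    [E] contains it in one order only. *)
Lemma oriented_color_class (V : finType) (K : nat) (g : rel V) (E : {set V * V})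
    (c : V -> V -> option 'I_K) (k : 'I_K) :
  irreflexive g -> oriented_edge_set g E -> proper_coloring c ->
  uniq (edge_vertices (enum [pred e in E | c e.1 e.2 == Some k])).
Proof.
move=> girr [Eg Exor] [csym cirr cprop].
have noflip i j : (i, j) \in E -> (j, i) \notin E.
  by move=> ijE; have := Exor _ _ (Eg _ _ ijE); rewrite ijE.
apply: uniq_edge_vertices; first exact: enum_uniq.
  move=> [i j]; rewrite mem_enum inE /= => /andP[ijE _].
  by apply: contraTneq (Eg _ _ ijE) => ->; rewrite girr.
move=> [i j] [i' j']; rewrite !mem_enum !inE /=.
move=> /andP[ijE /eqP cij] /andP[ijE' /eqP cij'] neq.
have cji : c j i = Some k by rewrite csym.
have cji' : c j' i' = Some k by rewrite csym.
apply/and4P; split; apply/eqP => eq_v.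
- by rewrite eq_v in cij neq; rewrite (cprop _ _ _ _ cij cij') eqxx in neq.
- rewrite eq_v in cij ijE; rewrite (cprop _ _ _ _ cij cji') in ijE.
  by have := noflip _ _ ijE; rewrite ijE'.
- rewrite eq_v in cji ijE; rewrite (cprop _ _ _ _ cji cij') in ijE.
  by have := noflip _ _ ijE; rewrite ijE'.
- by rewrite eq_v in cji neq; rewrite (cprop _ _ _ _ cji cji') eqxx in neq.
Qed.

Lemma natr_le_mul_ceil (R : archiRealFieldType) (N K : nat) : (0 < K)%N ->
  N%:R <= K%:R * (Num.ceil (N%:R / K%:R : R))%:~R :> R.
Proof.
by move=> K0; rewrite mulrC -ler_pdivrMr ?ltr0n //; exact: ceil_ge.
Qed.

Theorem theorem6 (d : measure_display) (T : measurableType d) (R : realType)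
    (P : probability T R) (n p : nat)
    (X : 'I_n -> {RV P >-> p.-tuple R})
    (g : rel 'I_n) (E : {set 'I_n * 'I_n})
    (h : 'I_n * 'I_n ->
         p.-tuple R * p.-tuple R -> R)
    (b sigma2 : R) :
  mutually_independent X ->
  simple_graph g -> oriented_edge_set g E -> E != finset.set0 ->
  (forall e, e \in E -> measurable_fun setT (h e)) ->
  (forall e, e \in E -> P.-integrable setT (EFin \o edge_term X h e)) ->
  0 <= b -> 0 <= sigma2 -> ~ (b = 0 /\ sigma2 = 0) ->
  (forall e, e \in E ->
     {ae P, forall w,
       `|edge_term X h e w - fine 'E_P[edge_term X h e]| <= b}) ->
  (forall e, e \in E -> ('V_P[edge_term X h e] <= sigma2%:E)%E) ->
  let U := graph_sum X h E in
  let N := #|E| in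
  let K := (max_degree g).+1 in
  let Nstar : R := K%:R * (Num.ceil (N%:R / K%:R : R))%:~R in
  forall t : R, 0 < t ->
    (P [set w | (U w - fine 'E_P[U]) / Nstar > t]%R
     <= (expR (- (Nstar * t ^+ 2
                  / (2 * (max_degree g).+1%:R * (sigma2 + b * t / 3)))))%:E)%E.
Proof.
move=> indepX [gsym girr] orient E0 mh ih b0 s20 nz hb hv U N K Nstar t t0.
have [Eg _] := orient.
pose mu e := fine 'E_P[edge_term X h e].
have K0 : (0 < K)%N by [].
have KR : 0 < K%:R :> R by rewrite ltr0n.
have NNstar : N%:R <= Nstar by exact: natr_le_mul_ceil.
have Nstar0 : 0 < Nstar.
  by apply: lt_le_trans NNstar; rewrite ltr0n /N card_gt0.
have mterm e : e \in E -> measurable_fun setT (edge_term X h e).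
  by move=> eE; exact/measurable_EFinP/(measurable_int _ (ih e eE)).
have mU : measurable_fun setT U.
  rewrite /U /graph_sum; under eq_fun do rewrite -big_enum.
  by apply: measurable_sum_in => e; rewrite mem_enum; exact: mterm.
have EUE : fine 'E_P[U] = \sum_(e in E) mu e.
  pose f e w := if e \in E then (edge_term X h e w)%:E else 0%E.
  have intf e : P.-integrable setT (f e).
    rewrite /f; case: (boolP (e \in E)) => [/ih //|_]; exact: integrable0.
  rewrite unlock; transitivity (fine (\int[P]_w (\sum_(e in E) f e w)%E)).
    congr fine; apply: eq_integral => w _; rewrite -sumEFin.
    by apply: eq_bigr => e eE; rewrite /f eE.
  rewrite integral_sum // (eq_bigr (fun e => (mu e)%:E)) ?sumEFin // => e eE.
  rewrite /mu unlock fineK; last exact: integrable_fin_num (ih e eE).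
  by apply: eq_integral => w _; rewrite /f eE.
have [s [sge0 sb3 st]] := bernstein_parameter b0 s20 nz t0.
set D := sigma2 + b * t / 3 in st *.
pose psi := s ^+ 2 * sigma2 / 2 / (1 - s * b / 3).
have psi0 : 0 <= psi.
  rewrite /psi !mulr_ge0 ?sqr_ge0 ?invr_ge0 // subr_ge0 ler_pdivrMr // mul1r.
  exact: ltW.
have mgf e : e \in E -> (\int[P]_w (expR (s * (edge_term X h e w - mu e)))%:E
    <= (expR psi)%:E)%E.
  move=> eE; have iterm := ih e eE.
  have muE : (\int[P]_w (edge_term X h e w)%:E = (mu e)%:E)%E.
    by rewrite /mu unlock fineK // integrable_fin_num.
  have icst : P.-integrable setT (EFin \o cst (mu e)).
    exact: finite_measure_integrable_cst.
  apply: (@bernstein_mgf _ _ _ P (fun w => edge_term X h e w - mu e) b) => //.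
  - rewrite (_ : _ \o _ = ((EFin \o edge_term X h e) \- (EFin \o cst (mu e)))%E).
      exact: integrableB.
    by apply/funext => w /=.
  - under eq_integral do rewrite EFinB.
    rewrite integralB // muE integral_cst //= probability_setT mule1.
    by rewrite subee.
  - apply: le_trans (hv e eE); rewrite /variance covariance.unlock.
    rewrite /mu !expectation.unlock le_eqVlt; apply/orP; left; apply/eqP.
    by apply: eq_integral => w _; rewrite expr2.
  - exact: hb.
have deg x : (#|[pred y | g x y]| < K)%N by rewrite ltnS /max_degree (leq_bigmax x).
have [c cP cE] := vizing gsym girr deg.
(* Every edge in [E] is coloured, so the default colour is never used on [E]. *)
pose col (e : 'I_n * 'I_n) := odflt ord0 (c e.1 e.2).
have colE e k : e \in E -> (col e == k) = (c e.1 e.2 == Some k).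
  case: e => i j /Eg; rewrite -cE /col /=; by case: (c i j).
pose M k := enum [pred e in E | c e.1 e.2 == Some k].
pose a k w := \sum_(e <- M k) (s * (edge_term X h e w - mu e) - psi).
have sum_a w : \sum_k a k w = s * (U w - fine 'E_P[U]) - N%:R * psi.
  rewrite EUE /U /graph_sum -sumrB mulr_sumr.
  have -> : N%:R * psi = \sum_(e in E) psi by rewrite sumr_const mulr_natl.
  rewrite -sumrB (partition_big col xpredT) //=; apply: eq_bigr => k _.
  rewrite /a /M big_enum /=; apply: eq_bigl => e; rewrite inE.
  by have [eE|//] := boolP (e \in E); rewrite /= colE.
have ME k e : e \in M k -> e \in E by rewrite mem_enum inE => /andP[].
have ma k : measurable_fun setT (a k).
  apply: measurable_sum_in => e /ME eE; apply: measurable_funB => //.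
  by apply: measurable_funM => //; apply: measurable_funB => //; exact: mterm.
pose B := Nstar / K%:R * (t ^+ 2 / (2 * D)).
have -> : - (Nstar * t ^+ 2 / (2 * (max_degree g).+1%:R * D)) = - B.
  by rewrite /B -/K !invfM; ring.
have sub : [set w | (U w - fine 'E_P[U]) / Nstar > t] `<=`
    [set w | K%:R * B <= \sum_k a k w].
  move=> w /=; rewrite ltr_pdivlMr // => /ltW tN; rewrite sum_a.
  have -> : K%:R * B = Nstar * (t ^+ 2 / (2 * D)).
    by rewrite /B mulrA [K%:R * _]mulrC divfK // gt_eqF.
  apply: (le_trans (ler_wpM2l (ltW Nstar0) st)); rewrite -/psi mulrBr.
  apply: lerB; last exact: ler_wpM2r.
  by rewrite mulrCA [Nstar * t]mulrC; exact: ler_wpM2l.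
apply: (@le_trans _ _ (P [set w | K%:R * B <= \sum_k a k w])).
  apply: le_measure => //; rewrite inE.
  - rewrite (_ : [set w | _] =
      (fun w => (U w - fine 'E_P[U]) / Nstar) @^-1` `]t, +oo[%classic); last first.
      by apply/seteqP; split => w; rewrite /= in_itv /= andbT.
    rewrite -[X in measurable X]setTI; apply: measurable_funM => //.
    exact: measurable_funB.
  - rewrite (_ : [set w | _] =
      (fun w => \sum_k a k w) @^-1` `[K%:R * B, +oo[%classic); last first.
      by apply/seteqP; split => w; rewrite /= in_itv /= andbT.
    by rewrite -[X in measurable X]setTI; apply: measurable_sum.
apply: exp_moment_average_tail => // k.
apply: (matching_exp_moment indepX).
- by move=> e /ME; exact: mh.
- exact: oriented_color_class.
- by move=> e /ME; exact: mgf.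
Qed.
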